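(* Let $n \geq 2$ be an integer, let $X$ be the winning streak Markov chain on $\{1,\ldots,n\}$, and let $\mu,\nu$ be probability distributions on $\{1,\ldots,n\}$. Then the optimal transport time $H(\mu,\nu)$ from $\mu$ to $\nu$ using $X$ satisfies $$H(\mu,\nu) = \max_{j\in\{1,\ldots,n\}}\Big(\mathbb{E}_{Z\sim\nu}\big[2^Z \mathbf{1}_{\{Z\leq j\}}\big] - \mathbb{E}_{Z\sim\mu}\big[2^Z \mathbf{1}_{\{Z\leq j\}}\big]\Big).$$ In particular, $$\Big(\mathbb{E}_{Z\sim\nu}\big[2^Z\big] - \mathbb{E}_{Z\sim\mu}\big[2^Z\big]\Big)_+ \leq H(\mu,\nu) \leq 2^n = O(2^n).$$
   Context: The winning streak Markov chain on $\{1,\ldots,n\}$ is the discrete-time Markov chain with transition probabilities $p_{i,i+1} = 1/2$ for $1 \leq i \leq n-1$, $p_{i,1} = 1/2$ for $1 \leq i \leq n$, $p_{n,n} = 1/2$, and $p_{i,j} = 0$ otherwise. For probability distributions $\mu,\nu$ on the state space, the optimal transport time (also called access time) is $H(\mu,\nu) := \inf_{T} \mathbb{E}[T]$, where $X_0 \sim \mu$ and the infimum is over all almost surely finite, possibly randomized, stopping times $T$ of $X$ such that $X_T \sim \nu$. (A randomized stopping time is a stopping time with respect to a filtration $\mathcal{F}_t = \sigma(U, X_0,\dots,X_t)$, where $U$ is uniform on $[0,1]$ and independent of $X$.) $\mathbb{E}_{Z\sim\mu}$ denotes expectation when $Z$ has law $\mu$, $\mathbf{1}_A$ is the indicator of $A$,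 and $x_+ := \max\{x,0\}$. *)

(* Defs.v *)
From HB Require Import structures.
From mathcomp Require Import all_boot all_order all_algebra.
From mathcomp Require Import all_classical all_reals all_analysis.

Set Implicit Arguments.
Unset Strict Implicit.
Unset Printing Implicit Defensive.

Import Order.TTheory GRing.Theory Num.Theory.
Local Open Scope classical_set_scope.
Local Open Scope ring_scope.

(* The state space {1, ..., n} is encoded as 'I_n = {0, ..., n-1}: the ordinal
   i stands for the state label i = i + 1. *)
Definition label (n : nat) (i : 'I_n) : nat := i.+1.

Definition is_distribution (R : realType) (n : nat) (mu : 'I_n -> R) : Prop :=
  (forall i, 0 <= mu i) /\ \sum_(i < n) mu i = 1.

(* E_{Z ~ mu}[f Z], with f a function of the label of the state Z. *)
Definition mean (R : realType) (n : nat) (mu : 'I_n -> R) (f : nat -> R) : R :=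
  \sum_(i < n) mu i * f (label i).

(* For n >= 2 the targets i + 1, 1 and n (from i = n) listed below are pairwise
   distinct, so that every row sums to 1; n = 1 is not meant to be covered. *)
Definition winning_streak (R : realType) (n : nat) (i j : 'I_n) : R :=
  if [|| label j == (label i).+1, label j == 1%N
       | (label i == n) && (label j == n)]
  then 2^-1 else 0.

Section Process.
Context (R : realType) (d : measure_display) (Omega : measurableType d).
Variables (P : probability Omega R) (n : nat).
Variables (U : {RV P >-> R}) (X : nat -> Omega -> 'I_n).

(* The Markov property is the elementary one, multiplied out so that
   conditioning on null events is harmless. *)
Definition is_markov_chain (mu : 'I_n -> R) (p : 'I_n -> 'I_n -> R) : Prop :=
  [/\ forall t (A : set 'I_n), measurable (X t @^-1` A),
      forall i, P [set w | X 0%N w = i] = (mu i)%:E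
    & forall (t : nat) (x : nat -> 'I_n),
        P [set w | forall s, (s <= t.+1)%N -> X s w = x s] =
        (P [set w | forall s, (s <= t)%N -> X s w = x s]
           * (p (x t) (x t.+1))%:E)%E ].

Definition is_uniform01 : Prop :=
  forall A : set R, measurable A ->
    distribution P U A = uniform_prob (@ltr01 R) A.

Definition sigma_U : set (set Omega) := preimage_set_system setT U measurable.

Definition sigma_X : set (set Omega) :=
  <<s \bigcup_s preimage_set_system setT (X s) setT >>.

Definition indep_UX : Prop :=
  forall A B, sigma_U A -> sigma_X B -> P (A `&` B) = (P A * P B)%E.

Definition filtration (t : nat) : set (set Omega) :=
  <<s sigma_U `|`
      \bigcup_(s in [set s | (s <= t)%N]) preimage_set_system setT (X s) setT >>.

(* Random times take values in {0, 1, 2, ...} together with +oo = None. *)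
Definition is_stopping_time (T : Omega -> option nat) : Prop :=
  forall t, filtration t [set w | exists2 k, T w = Some k & (k <= t)%N].

Definition time_ereal (k : option nat) : \bar R :=
  if k is Some m then m%:R%:E else +oo%E.

Definition mean_time (T : Omega -> option nat) : \bar R :=
  (\int[P]_w time_ereal (T w))%E.

Definition transports_to (nu : 'I_n -> R) (T : Omega -> option nat) : Prop :=
  [/\ is_stopping_time T,
      {ae P, forall w, T w != None}
    & forall i, P [set w | exists2 k, T w = Some k & X k w = i] = (nu i)%:E ].

(* H(mu, nu), where mu is the law of X 0. *)
Definition transport_time (nu : 'I_n -> R) : \bar R :=
  ereal_inf [set mean_time T | T in [set T | transports_to nu T]].

End Process.

(* Main.v *)
Require Import Defs.
From HB Require Import structures.
From mathcomp Require Import all_boot all_order all_algebra.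
From mathcomp Require Import all_classical all_reals all_analysis.
From mathcomp Require Import lra.

Set Implicit Arguments.
Unset Strict Implicit.
Unset Printing Implicit Defensive.

Import Order.TTheory GRing.Theory Num.Theory.
Import numFieldNormedType.Exports.
Local Open Scope classical_set_scope.
Local Open Scope ring_scope.

(** The transport time is computed by pairing stopping times with the potentials
    h_j(i) = 2^i 1{i <= j}. From a state i the chain moves to 1, where h_j = 2,
    or one step up, each with probability 1/2; hence one step increases the mean
    of h_j by exactly 1 from every i different from j, and by less than 1 from
    i = j ([truncated_pow2_drift]). So E[h_j(X_T)] <= E[h_j(X_0)] + E[T] for
    every stopping time T, which bounds E[T] from below by the j-th term of the
    maximum ([mean_time_lower_bound]), and equality holds as soon as T never
    lets the chain leave j.

    The filling rule provides such a T. At each time it stops, at each state, as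
    much of the surviving mass as the target still lacks there. The state that
    is filled last (or never filled in finite time) stops everything that ever
    reaches it ([fill_halting_state]); it is the j for which equality holds, and
    since the potential is bounded, the resulting identity also shows that the
    surviving mass vanishes, so that the target law is reached
    ([filling_stop_cvg], [filling_work_cvg]).

    Probability and linear algebra meet in the notion of a flow: the masses
    P(T >= t, X_t = i) arriving at i at time t and P(T = t, X_t = i) stopping
    there. The law of X_T and the mean of T depend only on the flow. Every
    stopping time induces a flow ([stopping_flow]), because the Markov property
    extends to the filtration enlarged by U: on each cylinder of the path up to
    t, an event known at time t is an event about U alone ([filtrationP]),
    hence independent of the path. Conversely every flow is induced by a
    stopping time ([flow_time]) that uses the single uniform variable U as
    a threshold for the survival probability along the path. *)

(** * Flows and the filling rule *)

Section Flow.
Context (R : realType) (n : nat).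
Variables (p : 'I_n -> 'I_n -> R) (mu : 'I_n -> R).

(** The deterministic shadow of a stopping time: [arr t i] is the mass that is
    at [i] at time [t] and was not stopped earlier, [stop t i] the part of it
    stopped there and then. *)
Definition is_flow (arr stop : nat -> 'I_n -> R) : Prop :=
  [/\ forall i, arr 0%N i = mu i,
      forall t i, 0 <= stop t i <= arr t i
    & forall t j, arr t.+1 j = \sum_i (arr t i - stop t i) * p i j].

(** Dynkin's formula for the time T /\ t: the left side is the mean of [h] at
    that time, and the last sum adds the mean increase of [h] over the steps
    taken before it. *)
Lemma flow_balance arr stop (h : 'I_n -> R) t : is_flow arr stop ->
  \sum_i arr t i * h i + \sum_(s < t) \sum_i stop s i * h i =
  \sum_i mu i * h i
  + \sum_(s < t) \sum_i (arr s i - stop s i) * (\sum_j p i j * h j - h i).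
Proof.
case=> arr0 _ arrS; elim: t => [|t IHt].
  by rewrite !big_ord0 !addr0; apply: eq_bigr => i _; rewrite arr0.
have arrSh : \sum_j arr t.+1 j * h j =
    \sum_i (arr t i - stop t i) * \sum_j p i j * h j.
  under eq_bigr do rewrite arrS mulr_suml.
  rewrite exchange_big; apply: eq_bigr => i _ /=.
  by rewrite mulr_sumr; apply: eq_bigr => j _; rewrite mulrA.
rewrite !big_ord_recr /= [RHS]addrA -IHt arrSh.
rewrite [X in _ = _ + X](_ : _ =
    \sum_i (arr t i - stop t i) * \sum_j p i j * h j
    - (\sum_i arr t i * h i - \sum_i stop t i * h i)); first by lra.
by rewrite -!sumrB; apply: eq_bigr => i _; rewrite mulrBr [X in _ - X]mulrBl.
Qed.

(** The pair of the arriving mass and of the mass that the target [nu] still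
    lacks at each state; the smaller of the two is stopped. *)
Fixpoint filling (nu : 'I_n -> R) t : ('I_n -> R) * ('I_n -> R) :=
  if t is s.+1 then
    let: (arr, room) := filling nu s in
    (fun j => \sum_i (arr i - Num.min (arr i) (room i)) * p i j,
     fun i => room i - Num.min (arr i) (room i))
  else (mu, nu).

Hypothesis p_ge0 : forall i j, 0 <= p i j.
Hypothesis p_sum1 : forall i, \sum_j p i j = 1.
Variable nu : 'I_n -> R.
Hypothesis mu_dist : is_distribution mu.
Hypothesis nu_dist : is_distribution nu.

Definition fill_arr t := (filling nu t).1.
Definition fill_room t := (filling nu t).2.
Definition fill_stop t i := Num.min (fill_arr t i) (fill_room t i).

Lemma fill_arrS t j :
  fill_arr t.+1 j = \sum_i (fill_arr t i - fill_stop t i) * p i j.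
Proof.
by rewrite /fill_stop /fill_arr /fill_room /=; case: (filling nu t).
Qed.

Lemma fill_roomS t i : fill_room t.+1 i = fill_room t i - fill_stop t i.
Proof.
by rewrite /fill_stop /fill_arr /fill_room /=; case: (filling nu t).
Qed.

Lemma fill_ge0 t i : 0 <= fill_arr t i /\ 0 <= fill_room t i.
Proof.
elim: t i => [|t IHt] i; first by split; [case: mu_dist | case: nu_dist].
rewrite fill_arrS fill_roomS; split; last by rewrite subr_ge0 ge_min lexx orbT.
by apply: sumr_ge0 => k _; rewrite mulr_ge0// subr_ge0 ge_min lexx.
Qed.

Lemma filling_is_flow : is_flow fill_arr fill_stop.
Proof.
split=> // [t i|t j]; last exact: fill_arrS.
have [arr0 room0] := fill_ge0 t i.
by rewrite le_min ge_min lexx arr0 room0.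
Qed.

(** Stopping removes the same mass from both sides and a step of the chain
    preserves mass. *)
Lemma fill_mass t : \sum_i fill_arr t i = \sum_i fill_room t i.
Proof.
elim: t => [|t IHt]; first by case: mu_dist => _ ->; case: nu_dist => _ ->.
under eq_bigr do rewrite fill_arrS.
rewrite exchange_big /=.
under eq_bigr do rewrite -mulr_sumr p_sum1 mulr1.
by under [RHS]eq_bigr do rewrite fill_roomS; rewrite !sumrB IHt.
Qed.

Lemma fill_arrS_mass t :
  \sum_i fill_arr t.+1 i = \sum_i (fill_arr t i - fill_stop t i).
Proof.
under eq_bigr do rewrite fill_arrS.
rewrite exchange_big /=.
by under eq_bigr do rewrite -mulr_sumr p_sum1 mulr1.
Qed.

Lemma fill_room_sum t i : fill_room t i = nu i - \sum_(s < t) fill_stop s i.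
Proof.
elim: t => [|t IHt]; first by rewrite big_ord0 subr0.
by rewrite fill_roomS IHt big_ord_recr /= opprD addrA.
Qed.

(** Mass passes through a state only after the target is filled there, and
    then the state stays filled. *)
Lemma fill_room_full t s i : (t < s)%N -> fill_stop t i < fill_arr t i ->
  fill_room s i = 0.
Proof.
move=> lt_ts; rewrite /fill_stop gt_min ltxx /= => full.
have full1 : fill_room t.+1 i = 0.
  by rewrite fill_roomS /fill_stop min_r ?subrr// ltW.
elim: s lt_ts => // s IHs; rewrite ltnS leq_eqVlt => /predU1P[<- //|/IHs r0].
by rewrite fill_roomS /fill_stop r0 min_r ?subrr//; case: (fill_ge0 s i).
Qed.

(** Were every state left at some time, then after the latest of these times
    every state would be filled. The missing mass, and with it the mass still
    in motion, would be zero, although some mass has just left a state. *)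
Lemma fill_halting_state : exists j, forall t, fill_stop t j = fill_arr t j.
Proof.
apply: contrapT => /forallNP nohalt.
have overflow j : exists t, fill_stop t j < fill_arr t j.
  have /existsNP[t /eqP neq] := nohalt j.
  by exists t; rewrite lt_neqAle neq /fill_stop ge_min lexx.
have [T overT] := choice overflow.
have [i0] : exists i : 'I_n, true.
  case: (pickP (fun _ : 'I_n => true)) => [i _|none]; first by exists i.
  by have [_] := mu_dist; rewrite big_pred0// => /esym/eqP; rewrite oner_eq0.
move=> _; pose j := [arg max_(i > i0) T i]%N.
have T_le i : (T i <= T j)%N.
  by rewrite /j; case: arg_maxnP => // k _ /(_ i); apply.
have /eqP := fill_arrS_mass (T j).
rewrite fill_mass big1 => [|i _]; last first.
  exact: (@fill_room_full (T i) (T j).+1 i (T_le i) (overT i)).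
rewrite eq_sym psumr_eq0 => [/allP /(_ j)|i _]; last first.
  by rewrite subr_ge0 ge_min lexx.
by rewrite mem_index_enum /= gt_eqF ?subr_gt0// => /(_ isT).
Qed.

End Flow.

(** * The potentials of the winning streak chain *)

Section Potential.
Context (R : realType) (n : nat) (hn : (2 <= n)%N).

Definition truncated_pow2 (j : 'I_n) (z : nat) : R :=
  2 ^+ z * (z <= label j)%N%:R.

(** From [n] the second target is [n] itself, whence the minimum. The two
    targets differ because [2 <= n], so the two halves are never merged. *)
Lemma winning_streak_step (f : nat -> R) (i : 'I_n) :
  \sum_k winning_streak R i k * f (label k)
  = 2^-1 * (f 1%N + f (minn (label i).+1 n)).
Proof.
case: n hn i => [|m] // hm i.
pose next := inord (minn i.+1 m) : 'I_m.+1.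
have nextE : next = minn i.+1 m :> nat by rewrite inordK// ltnS geq_minr.
have next0 : next != ord0.
  by rewrite -val_eqE /= nextE -lt0n leq_min; exact: hm.
rewrite (bigD1 ord0)//= (bigD1 next)//= big1 => [|k /andP[k0 kn]].
  rewrite /winning_streak /label /= addr0 mulrDr nextE.
  rewrite minnSS; congr (_ + _ * _).
  have [_|lt_mi] := leqP i.+1 m; first by rewrite eqxx.
  have -> : i.+1 = m.+1 by apply/eqP; rewrite eqn_leq ltn_ord.
  by rewrite eqxx !orbT.
rewrite /winning_streak /label /= ifF ?mul0r//; apply/negbTE.
rewrite -!val_eqE /= nextE in k0 kn.
rewrite !eqSS; apply/negP => /or3P[/eqP kE|/eqP kE|/andP[/eqP iE /eqP kE]].
- by move: kn; rewrite kE (minn_idPl _) ?eqxx// -kE -ltnS.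
- by rewrite kE in k0.
- by move: kn; rewrite iE kE (minn_idPr _) ?eqxx.
Qed.

Lemma winning_streak_ge0 (i j : 'I_n) : 0 <= winning_streak R i j.
Proof.
by rewrite /winning_streak; case: ifP => _; rewrite ?invr_ge0 ?ler0n.
Qed.

Lemma winning_streak_sum1 (i : 'I_n) : \sum_j winning_streak R i j = 1.
Proof.
have := winning_streak_step (fun=> 1) i.
under eq_bigr do rewrite mulr1.
by move=> ->; lra.
Qed.

(** Doubling the potential at each level makes up for the probability 1/2 of
    moving up, and the reset to state 1 contributes 2 / 2. The correction at
    [i = j] comes from the truncation: the potential drops to 0 above [j], and
    at the top state it fails to double. *)
Lemma truncated_pow2_drift (j i : 'I_n) :
  \sum_k winning_streak R i k * truncated_pow2 j (label k)
    - truncated_pow2 j (label i) =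
  1 - (i == j)%:R * 2 ^+ (minn (label i) n.-1).
Proof.
rewrite winning_streak_step /truncated_pow2 expr1 /= mulr1 /label.
have [lt_in|] := ltnP i.+1 n.
  rewrite (minn_idPl lt_in) (minn_idPl _); last first.
    by rewrite -ltnS (ltn_predK lt_in).
  rewrite !ltnS (leq_eqVlt i j) -val_eqE exprS /=.
  have [->|_] := eqVneq; rewrite ?ltnn /= ?mulr1 ?mulr0 ?mul1r ?mul0r;
    first lra.
  nra.
move=> le_ni; have iE : i.+1 = n by apply/eqP; rewrite eqn_leq ltn_ord.
rewrite iE (minn_idPr (leqnSn n)) (minn_idPr (leq_pred n)).
have -> : (i == j) = (n <= j.+1)%N.
  by rewrite -val_eqE -eqSS /= iE eqn_leq (ltn_ord j) andbT.
rewrite -[in 2 ^+ n](ltn_predK hn) exprS /=; nra.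
Qed.

End Potential.

(** * Convergence of the filling rule with a halting state *)

Section Convergence.

Lemma cvg_weighted_sum (R : realType) (n : nat) (u : nat -> 'I_n -> R)
    (l h : 'I_n -> R) : (forall i, u t i @[t --> \oo] --> l i) ->
  \sum_i u t i * h i @[t --> \oo] --> \sum_i l i * h i.
Proof.
move=> ul; apply: cvg_big => [|i _]; first exact: add_continuous.
exact: cvgMr_tmp.
Qed.

Context (R : realType) (n : nat).
Variables (p : 'I_n -> 'I_n -> R) (mu nu : 'I_n -> R).
Hypothesis p_ge0 : forall i j, 0 <= p i j.
Hypothesis p_sum1 : forall i, \sum_j p i j = 1.
Hypothesis mu_dist : is_distribution mu.
Hypothesis nu_dist : is_distribution nu.
Variables (j : 'I_n) (h : 'I_n -> R).
Hypothesis h_ge0 : forall i, 0 <= h i.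
Hypothesis drift1 : forall i, i != j -> \sum_k p i k * h k - h i = 1.
Let arr := fill_arr p mu nu.
Let room := fill_room p mu nu.
Let stop := fill_stop p mu nu.
Hypothesis halt : forall t, stop t j = arr t j.

(** The drift differs from 1 only at [j], where no mass takes a step, so the
    balance identity counts the steps. *)
Lemma filling_work t :
  \sum_(s < t) \sum_i (arr s i - stop s i) =
  \sum_i arr t i * h i + \sum_i (\sum_(s < t) stop s i) * h i
  - \sum_i mu i * h i.
Proof.
have -> : \sum_i (\sum_(s < t) stop s i) * h i =
    \sum_(s < t) \sum_i stop s i * h i.
  by rewrite exchange_big /=; apply: eq_bigr => i _; rewrite mulr_suml.
rewrite (flow_balance h t (filling_is_flow p_ge0 mu_dist nu_dist)) addrC addrA.
rewrite addNr add0r; apply: eq_bigr => s _; apply: eq_bigr => i _.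
have [->|ij] := eqVneq i j; last by rewrite drift1// mulr1.
by rewrite -/(stop _ _) -/(arr _ _) halt subrr mul0r.
Qed.

Let arr_ge0 t i : 0 <= arr t i.
Proof. by case: (fill_ge0 p_ge0 mu_dist nu_dist t i). Qed.

Let room_ge0 t i : 0 <= room t i.
Proof. by case: (fill_ge0 p_ge0 mu_dist nu_dist t i). Qed.

Let stop_sum t i : \sum_(s < t) stop s i = nu i - room t i.
Proof. by rewrite /room fill_room_sum opprB addrC subrK. Qed.

Lemma filling_arr_le1 t i : arr t i <= 1.
Proof.
have [_ <-] := nu_dist; rewrite (le_trans (y := \sum_i arr t i))//.
  by rewrite (bigD1 i)//= lerDl sumr_ge0.
rewrite fill_mass//; apply: ler_sum => k _.
have := stop_sum t k => /eqP; rewrite eq_sym subr_eq => /eqP ->.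
rewrite lerDr sumr_ge0// => s _; rewrite le_min.
by rewrite arr_ge0 room_ge0.
Qed.

(** The work is bounded since the potential is, so the series of the surviving
    masses converges; its terms therefore tend to 0. *)
Lemma filling_arr_cvg0 i : arr t i @[t --> \oo] --> 0.
Proof.
pose u t := \sum_i (arr t i - stop t i).
have u_ge0 t : 0 <= u t.
  by apply: sumr_ge0 => k _; rewrite subr_ge0 ge_min lexx.
have seriesE t : series u t = \sum_(s < t) u s.
  by rewrite /series /= big_mkord.
have u0 : u t @[t --> \oo] --> 0.
  apply: cvg_series_cvg_0; apply: nondecreasing_is_cvgn.
    by apply/nondecreasing_seqP => t; rewrite !seriesE big_ord_recr lerDl.
  exists (\sum_i h i + \sum_i nu i * h i) => _ [t _ <-].
  rewrite seriesE filling_work lerBlDr -addrA; apply: lerD.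
    by apply: ler_sum => k _; rewrite -[leRHS]mul1r ler_wpM2r// filling_arr_le1.
  apply: (le_trans (y := \sum_i nu i * h i)).
    by apply: ler_sum => k _; rewrite stop_sum ler_wpM2r// gerBl.
  rewrite lerDl sumr_ge0// => k _; rewrite mulr_ge0//.
  by case: mu_dist.
rewrite -cvg_shiftS; apply: (squeeze_cvgr _ (@cvg_cst _ _ _ _ _) u0).
apply: nearW => t; rewrite arr_ge0/=.
by rewrite /u -fill_arrS_mass// (bigD1 i)//= lerDl sumr_ge0// => k _.
Qed.

Lemma filling_mass_cvg0 : \sum_i arr t i @[t --> \oo] --> 0.
Proof.
have := @cvg_weighted_sum _ _ _ _ (fun=> 1) filling_arr_cvg0.
rewrite big1 => [|k _]; last by rewrite mul0r.
by under eq_fun do under eq_bigr do rewrite mulr1.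
Qed.

(** What is missing at time [t] has the same total mass as what is still in
    motion. *)
Lemma filling_stop_cvg i : \sum_(s < t) stop s i @[t --> \oo] --> nu i.
Proof.
under eq_fun do rewrite stop_sum.
suff room0 : room t i @[t --> \oo] --> 0.
  have : nu i - room t i @[t --> \oo] --> nu i - 0.
    by apply: cvgB room0; exact: cvg_cst.
  by rewrite subr0.
apply: (squeeze_cvgr _ (@cvg_cst _ _ _ _ _) filling_mass_cvg0).
apply: nearW => t; rewrite room_ge0/=.
by rewrite fill_mass// (bigD1 i)//= lerDl sumr_ge0// => k _; exact: room_ge0.
Qed.

Lemma filling_work_cvg :
  \sum_(s < t) \sum_i (arr s i - stop s i) @[t --> \oo] -->
  \sum_i nu i * h i - \sum_i mu i * h i.
Proof.
under eq_fun do rewrite filling_work.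
apply: cvgB; last exact: cvg_cst.
have arr0 := @cvg_weighted_sum _ _ _ _ h filling_arr_cvg0.
rewrite big1 in arr0 => [|i _]; last by rewrite mul0r.
have stop_nu := @cvg_weighted_sum _ _ _ _ h filling_stop_cvg.
have : \sum_i arr t i * h i + \sum_i (\sum_(s < t) stop s i) * h i
    @[t --> \oo] --> 0 + \sum_i nu i * h i by exact: cvgD.
by rewrite add0r.
Qed.

End Convergence.

(** * Randomised events and the Markov property *)

Section History.
Context (R : realType) (d : measure_display) (Omega : measurableType d).
Context (P : probability Omega R).

Lemma total_probability (F : finType) (W : Omega -> F) (A : set Omega) :
  measurable A -> (forall f, measurable (W @^-1` [set f])) ->
  P A = (\sum_f P (A `&` W @^-1` [set f]))%E.
Proof.
move=> mA mW.
have AE : A = \bigcup_(f in [set: F]) (A `&` W @^-1` [set f]).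
  by apply/seteqP; split=> [w Aw|w [f _ []]//]; exists (W w).
rewrite {1}AE measure_fin_bigcup//; first last.
- by move=> f _; exact: measurableI.
- apply/trivIsetP => f g _ _ /eqP fg; apply/seteqP.
  by split=> // w [[_ /= Wf] [_ /= Wg]]; apply: fg; rewrite -Wf -Wg.
- exact: finite_finset.
- rewrite [RHS]fsbig_seq ?index_enum_uniq//; apply: eq_fsbigl.
  by apply/seteqP; split=> f //= _; exact: mem_index_enum.
Qed.

Context (n : nat) (U : {RV P >-> R}) (X : nat -> Omega -> 'I_n).

Lemma uniform01_cdf (s : R) : is_uniform01 U -> 0 <= s <= 1 ->
  P (U @^-1` `]-oo, s]) = s%:E.
Proof.
move=> hU /andP[s0 s1].
have := hU [set` `]-oo, s]] (measurable_itv _).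
rewrite /distribution /pushforward => ->.
rewrite /uniform_prob integral_uniform_pdf.
rewrite (_ : _ `&` _ = [set` `[0, s]]); last first.
  apply/seteqP; split=> x /=; rewrite !in_itv /=.
    by move=> [xs /andP[-> _]].
  by move=> /andP[-> xs]; split=> //; exact: le_trans s1.
under eq_integral => x.
  rewrite inE /= in_itv /= => /andP[x0 xs].
  rewrite /uniform_pdf x0 (le_trans xs s1) subr0 invr1.
  over.
rewrite integral_cst//= mul1e.
rewrite lebesgue_measure_itv /= lte_fin.
have [_|] := ltP 0 s; first by rewrite -EFinB subr0.
by move=> s0'; congr (_%:E); apply/eqP; rewrite eq_le s0.
Qed.

Definition history t (w : Omega) : {ffun 'I_t.+1 -> 'I_n} :=
  [ffun s => X (val s) w].

Lemma filtration_le t A : (forall t (B : set 'I_n), measurable (X t @^-1` B)) ->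
  filtration U X t A -> measurable A.
Proof.
move=> mX; apply: smallest_sub; first exact: sigma_algebra_measurable.
move=> B [[C mC <-]|[s _ [C _ <-]]]; rewrite setTI.
  by rewrite -[X in measurable X]setTI; exact: measurable_funP.
exact: mX.
Qed.

Lemma filtrationI t A B : filtration U X t A -> filtration U X t B ->
  filtration U X t (A `&` B).
Proof. exact: (@measurableI _ (g_sigma_algebraType _)). Qed.

Lemma history_bigcap t f : history t @^-1` [set f] =
  \bigcap_(s in [set: 'I_t.+1]) (X (val s) @^-1` [set f s]).
Proof.
apply/seteqP; split=> [w <- s _|w hw] /=; first by rewrite ffunE.
by apply/ffunP => s; rewrite ffunE; exact: hw.
Qed.

Lemma history_sigma_X t f : sigma_X X (history t @^-1` [set f]).
Proof.
rewrite history_bigcap.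
apply: (@fin_bigcap_measurable _ (g_sigma_algebraType _)) => [|s _].
  exact: finite_finset.
apply: sub_sigma_algebra; exists (val s) => //.
by exists [set f s] => //; rewrite setTI.
Qed.

Lemma filtration_history t f : filtration U X t (history t @^-1` [set f]).
Proof.
rewrite history_bigcap.
apply: (@fin_bigcap_measurable _ (g_sigma_algebraType _)) => [|s _].
  exact: finite_finset.
apply: sub_sigma_algebra; right; exists (val s); first by rewrite /= -ltnS.
by exists [set f s] => //; rewrite setTI.
Qed.

Lemma filtration_U t (B : set R) : measurable B -> filtration U X t (U @^-1` B).
Proof.
by move=> mB; apply: sub_sigma_algebra; left; exists B => //; rewrite setTI.
Qed.

(** Along a given path up to time [t], only [U] is left to decide an event known
    at time [t]. The events with this property form a sigma-algebra that
    contains the generators; conversely, there are finitely many such paths. *)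
Lemma filtrationP t A : filtration U X t A <->
  forall f, exists2 B : set R, measurable B &
    forall w, history t w = f -> (A w <-> B (U w)).
Proof.
split=> [|hA].
  move: A; apply: smallest_sub; first split.
  - by move=> f; exists set0.
  - move=> A hA f; have [B mB AB] := hA f.
    exists (~` B); first exact: measurableC.
    by move=> w /AB [AB1 AB2]; split=> [[_ nA] /AB2//|nB]; split=> // /AB1.
  - move=> A hA f.
    have /choice[B BP] k : exists B : set R, measurable B /\
        forall w, history t w = f -> (A k w <-> B (U w)).
      by have [B] := hA k f; exists B.
    exists (\bigcup_k B k).
      by apply: bigcup_measurable => k _; case: (BP k).
    move=> w wf; split=> -[k _ kw]; exists k => //;
      by case: (BP k) => _ /(_ w wf) [h1 h2]; auto.
  move=> A [[B mB <-]|[s st [D _ <-]]] f; rewrite setTI; first by exists B.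
  have [Df|nDf] := pselect (D (f (Ordinal (st : (s < t.+1)%N)))).
    by exists setT => // w wf; split=> // _; move: Df; rewrite -wf ffunE.
  exists set0 => // w wf; split=> // Dw; apply: nDf; rewrite -wf ffunE.
  exact: Dw.
have /choice[B BP] f : exists B : set R, measurable B /\
    forall w, history t w = f -> (A w <-> B (U w)).
  by have [B] := hA f; exists B.
have -> : A = \bigcup_(f in [set: {ffun 'I_t.+1 -> 'I_n}])
    (U @^-1` B f `&` history t @^-1` [set f]).
  apply/seteqP; split=> [w Aw|w [f _ [Bw wf]]].
    exists (history t w) => //; split=> //.
    by case: (BP (history t w)) => _ /(_ w erefl) [+ _]; apply.
  by case: (BP f) => _ /(_ w wf) [_]; apply.
apply: (@fin_bigcup_measurable _ (g_sigma_algebraType _)) => [|f _].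
  exact: finite_finset.
apply: filtrationI; last exact: filtration_history.
by apply: filtration_U; case: (BP f).
Qed.

Lemma indep_U_sigma_X (B : set R) (C : set Omega) :
  indep_UX U X -> measurable B -> sigma_X X C ->
  P (U @^-1` B `&` C) = (P (U @^-1` B) * P C)%E.
Proof.
by move=> indep mB ?; apply: indep => //; exists B => //; rewrite setTI.
Qed.

Variables (mu : 'I_n -> R) (p : 'I_n -> 'I_n -> R).
Hypothesis hX : is_markov_chain P X mu p.
Hypothesis hUX : indep_UX U X.

Lemma measurable_X t (A : set 'I_n) : measurable (X t @^-1` A).
Proof. by case: hX. Qed.
Hint Resolve measurable_X : core.

Lemma measurable_history t f : measurable (history t @^-1` [set f]).
Proof. exact: filtration_le (filtration_history f). Qed.
Hint Resolve measurable_history : core.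

(** The Markov property of the definition concerns paths extended to all times;
    the extension past [t] by the constant [j] is read at [t.+1] only. *)
Lemma history_step t f j :
  P (history t @^-1` [set f] `&` X t.+1 @^-1` [set j]) =
  (P (history t @^-1` [set f]) * (p (f ord_max) j)%:E)%E.
Proof.
have [_ _ /(_ t (fun s => if (s <= t)%N then f (inord s) else j))] := hX.
rewrite leqnn ltnn (_ : inord t = ord_max); last first.
  by apply/val_inj; rewrite /= inordK.
rewrite (_ : [set w | _] = history t @^-1` [set f] `&` X t.+1 @^-1` [set j]).
  move=> ->; congr (P _ * _)%E; apply/seteqP; split=> [w hw|w <- s st] /=.
    apply/ffunP => s; have st : (s <= t)%N by rewrite -ltnS.
    by rewrite ffunE hw// st inord_val.
  by rewrite st ffunE /= inordK.
apply/seteqP; split=> [w hw|w [wf wj] s] /=.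
  split; last by rewrite hw// ltnn.
  apply/ffunP => s; have st : (s <= t)%N by rewrite -ltnS.
  by rewrite ffunE hw ?st ?inord_val// ltnW.
rewrite leq_eqVlt => /predU1P[->|st]; first by rewrite ltnn.
by rewrite -ltnS st -wf ffunE /= inordK.
Qed.

Lemma markov_history t A f j : filtration U X t A ->
  P (A `&` history t @^-1` [set f] `&` X t.+1 @^-1` [set j]) =
  (P (A `&` history t @^-1` [set f]) * (p (f ord_max) j)%:E)%E.
Proof.
move=> /filtrationP/(_ f)[B mB AB].
have -> : A `&` history t @^-1` [set f] = U @^-1` B `&` history t @^-1` [set f].
  apply/seteqP; split=> w [Aw wf]; split=> //; have [h1 h2] := AB w wf.
    exact: h1.
  exact: h2.
have sXh := @history_sigma_X t f.
have sXj : sigma_X X (X t.+1 @^-1` [set j]).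
  apply: sub_sigma_algebra; exists t.+1 => //.
  by exists [set j] => //; rewrite setTI.
have sXhj := @measurableI _ (g_sigma_algebraType _) _ _ sXh sXj.
rewrite -setIA (indep_U_sigma_X hUX mB sXhj) (indep_U_sigma_X hUX mB sXh).
by rewrite history_step muleA.
Qed.

(** The Markov property for the filtration enlarged by [U], obtained by summing
    over the paths up to [t]. *)
Lemma markov_filtration t A i j : filtration U X t A ->
  P (A `&` X t @^-1` [set i] `&` X t.+1 @^-1` [set j]) =
  (P (A `&` X t @^-1` [set i]) * (p i j)%:E)%E.
Proof.
move=> FA; pose A' := A `&` X t @^-1` [set i].
have FA' : filtration U X t A'.
  apply: filtrationI => //; apply: sub_sigma_algebra; right.
  exists t; first exact: leqnn.
  by exists [set i] => //; rewrite setTI.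
have mA' : measurable A' by exact: filtration_le FA'.
have mA'j := measurableI _ _ mA' (measurable_X t.+1 [set j]).
rewrite -/A' (total_probability mA'j (@measurable_history t)).
rewrite (total_probability mA' (@measurable_history t)) ge0_sume_distrl//.
apply: eq_bigr => f _; rewrite setIAC markov_history//.
have [->//|/eqP fi] := eqVneq (f ord_max) i.
rewrite (_ : A' `&` _ = set0) ?measure0 ?mul0e//.
by apply/seteqP; split=> // w [[_ /= wi] /= wf]; apply: fi; rewrite -wf ffunE.
Qed.

(** * The flow of a stopping time *)

Definition at_least (T : Omega -> option nat) t : set Omega :=
  [set w | forall k, T w = Some k -> (t <= k)%N].

Definition stops_at (T : Omega -> option nat) t : set Omega :=
  [set w | T w = Some t].

Lemma filtrationC t A : filtration U X t A -> filtration U X t (~` A).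
Proof. exact: (@measurableC _ (g_sigma_algebraType _)). Qed.

Lemma filtrationT t : filtration U X t setT.
Proof. exact: (@measurableT _ (g_sigma_algebraType _)). Qed.

Lemma filtrationS t A : filtration U X t A -> filtration U X t.+1 A.
Proof.
apply: sub_sigma_algebra2 => B [UB|[s /= st XB]]; first by left.
by right; exists s => //=; exact: leqW.
Qed.

Lemma at_least0 T : at_least T 0 = setT.
Proof. by apply/seteqP; split. Qed.

Lemma at_leastS T t :
  at_least T t.+1 = ~` [set w | exists2 k, T w = Some k & (k <= t)%N].
Proof.
apply/seteqP; split=> [w Tw [k /Tw]|w nT k Tk].
  by rewrite ltnNge => /negP.
by rewrite ltnNge; apply/negP => kt; apply: nT; exists k.
Qed.

Lemma is_stopping_timeP T :
  is_stopping_time U X T <-> forall t, filtration U X t (at_least T t.+1).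
Proof.
split=> hT t; first by rewrite at_leastS; apply: filtrationC; exact: hT.
by rewrite -[[set w | _]]setCK -at_leastS; apply: filtrationC; exact: hT.
Qed.

Section StoppedFlow.
Variable T : Omega -> option nat.
Hypothesis hT : is_stopping_time U X T.

Lemma filtration_at_least t : filtration U X t (at_least T t).
Proof.
case: t => [|t]; first by rewrite at_least0; exact: filtrationT.
by apply: filtrationS; have [+ _] := is_stopping_timeP T; apply.
Qed.

Lemma at_least_split t : at_least T t `&` ~` at_least T t.+1 = stops_at T t.
Proof.
apply/seteqP; split=> [w [Tt nTt]|w Tw].
  have /existsNP[k /not_implyP[Tk kt]] := nTt.
  rewrite /stops_at /= Tk; congr Some; apply/eqP.
  by rewrite eqn_leq (Tt _ Tk) andbT leqNgt; exact/negP.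
split=> [k|]; first by rewrite Tw => -[->].
by move=> /(_ t Tw); rewrite ltnn.
Qed.

Lemma filtration_stops_at t : filtration U X t (stops_at T t).
Proof.
rewrite -at_least_split; apply: filtrationI; first exact: filtration_at_least.
by apply: filtrationC; have [+ _] := is_stopping_timeP T; apply.
Qed.

Lemma measurable_at_least t : measurable (at_least T t).
Proof.
by apply: filtration_le; [exact: measurable_X | exact: filtration_at_least t].
Qed.

Lemma measurable_stops_at t : measurable (stops_at T t).
Proof.
by apply: filtration_le; [exact: measurable_X | exact: filtration_stops_at t].
Qed.
Hint Resolve measurable_at_least measurable_stops_at : core.

Definition arriving t i := fine (P (at_least T t `&` X t @^-1` [set i])).
Definition stopping t i := fine (P (stops_at T t `&` X t @^-1` [set i])).

Lemma arrivingE t i :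
  P (at_least T t `&` X t @^-1` [set i]) = (arriving t i)%:E.
Proof. by rewrite fineK// fin_num_measure//; exact: measurableI. Qed.

Lemma stoppingE t i :
  P (stops_at T t `&` X t @^-1` [set i]) = (stopping t i)%:E.
Proof. by rewrite fineK// fin_num_measure//; exact: measurableI. Qed.

(** The mass that takes a step from [i] at time [t]. *)
Lemma continuingE t i : P (at_least T t.+1 `&` X t @^-1` [set i]) =
  (arriving t i - stopping t i)%:E.
Proof.
rewrite EFinB -arrivingE -stoppingE.
rewrite (_ : at_least T t `&` _ = (at_least T t.+1 `&` X t @^-1` [set i])
    `|` (stops_at T t `&` X t @^-1` [set i])); last first.
  rewrite -setIUl -at_least_split; congr (_ `&` _); apply/seteqP; split.
    by move=> w Tw; have [|nTw] := pselect (at_least T t.+1 w); [left|right].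
  by move=> w [Tw k /Tw /ltnW //|[]].
rewrite measureU ?addeK ?fin_num_measure//; try exact: measurableI.
by apply/seteqP; split=> // w [[Tw _] [/Tw]]; rewrite ltnn.
Qed.

Lemma stopping_flow : is_flow p mu arriving stopping.
Proof.
split=> [i|t i|t j].
- apply/EFin_inj; rewrite -arrivingE at_least0 setTI.
  by case: hX => _ <- _.
- rewrite -!lee_fin -stoppingE -arrivingE measure_ge0 /=.
  apply: le_measure; rewrite ?inE; try exact: measurableI.
  by rewrite -at_least_split => w [[]].
apply/EFin_inj; rewrite -arrivingE.
have mX f : measurable (X t @^-1` [set f]) by [].
rewrite (total_probability _ mX); last exact: measurableI.
rewrite -sumEFin; apply: eq_bigr => i _.
rewrite EFinM -continuingE -(markov_filtration _ j).
  by rewrite setIAC.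
by have [+ _] := is_stopping_timeP T; apply.
Qed.

Lemma tail_probability t :
  P (at_least T t.+1) = (\sum_i (arriving t i - stopping t i))%:E.
Proof.
have mX f : measurable (X t @^-1` [set f]) by [].
rewrite (total_probability _ mX)// -sumEFin.
by apply: eq_bigr => i _; rewrite continuingE.
Qed.

(** A time is the number of integers below it, also when it is infinite. *)
Lemma time_erealE w :
  time_ereal R (T w) = (\sum_(0 <= t <oo) (\1_(at_least T t.+1) w)%:E)%E.
Proof.
have memE t : (w \in at_least T t.+1) =
    if T w is Some k then (t < k)%N else true.
  apply/idP/idP; rewrite inE /at_least /=; case: (T w) => [k|//].
    by move=> /(_ k erefl).
  by move=> tk _ [<-].
under eq_eseriesr do rewrite indicE memE.
case: (T w) => [k|] /=.
  rewrite (nneseries_split 0 k) => [|t _]; last by rewrite lee_fin.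
  rewrite add0n [X in (_ + X)%E]eseries0 ?adde0 => [|t kt _]; last first.
    by rewrite ltnNge kt.
  rewrite sumEFin big_nat; under eq_bigr => t /andP[_ ->] do [].
  by rewrite -big_nat sumr_const_nat subn0.
apply/esym/cvg_lim => //.
rewrite (_ : (fun m => _) = EFin \o (GRing.natmul 1)).
  by apply/cvgeryP/cvgr_idn.
apply/funext => m /=; rewrite sumEFin sumr_const_nat subn0.
by [].
Qed.

Lemma mean_timeE :
  mean_time P T =
  (\sum_(0 <= t <oo) (\sum_i (arriving t i - stopping t i))%:E)%E.
Proof.
rewrite /mean_time; under eq_integral do rewrite time_erealE.
rewrite integral_nneseries//.
  apply: eq_eseriesr => t _; rewrite integral_indic// setIT.
  exact: tail_probability.
move=> t; apply/measurable_realfun.measurable_EFinP.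
exact: measurable_realfun.measurable_indic.
Qed.

(** Stated for partial sums, so as to be compared with the partial sums of an
    arbitrary flow. *)
Lemma stopped_law_cvg i :
  (\sum_(0 <= t < m) stopping t i)%:E @[m --> \oo] -->
  P [set w | exists2 k, T w = Some k & X k w = i].
Proof.
rewrite [X in P X](_ : _ = \bigcup_t (stops_at T t `&` X t @^-1` [set i]));
    last first.
  by apply/seteqP; split=> w [k]; [move=> Tk Xk|move=> _ [Tk Xk]]; exists k.
rewrite (_ : (fun m => _) = fun m =>
    (\sum_(0 <= t < m) P (stops_at T t `&` X t @^-1` [set i]))%E); last first.
  apply/funext => m; rewrite -sumEFin.
  by apply: eq_bigr => t _; rewrite stoppingE.
apply: measure_sigma_additive => [t|]; first exact: measurableI.
apply/trivIsetP => s t _ _ /eqP st; apply/seteqP; split=> // w [[sw _] [tw _]].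
by apply: st; move: tw; rewrite /stops_at /= sw => -[].
Qed.

End StoppedFlow.

(** * A stopping time for a prescribed flow *)

Section Realization.
Variables arr stop : nat -> 'I_n -> R.
Hypothesis hflow : is_flow p mu arr stop.
Hypothesis hU : is_uniform01 U.

(** The conditional probability of not having stopped before [t], along the path
    [x]. A state that no mass reaches has ratio [stop / arr = 0 / 0 = 0], and so
    does not stop the path; this happens with probability 0. *)
Definition survival t (x : nat -> 'I_n) : R :=
  \prod_(s < t) (1 - stop s (x s) / arr s (x s)).

Lemma survivalS t x :
  survival t.+1 x = survival t x * (1 - stop t (x t) / arr t (x t)).
Proof. by rewrite /survival big_ord_recr. Qed.

Lemma survival_factor t i : 0 <= 1 - stop t i / arr t i <= 1.
Proof.
case: hflow => _ /(_ t i) /andP[s0 sa] _.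
have a0 := le_trans s0 sa.
rewrite subr_ge0 gerBl divr_ge0// andbT.
have [->|an0] := eqVneq (arr t i) 0; first by rewrite invr0 mulr0 ler01.
by rewrite ler_pdivrMr ?mul1r// lt_def an0.
Qed.

Lemma survival_itv t x : 0 <= survival t x <= 1.
Proof.
elim: t => [|t /andP[IH0 IH1]]; first by rewrite /survival big_ord0 lexx ler01.
have /andP[f0 f1] := survival_factor t (x t).
by rewrite survivalS mulr_ge0//= mulr_ile1.
Qed.

Lemma survival_le s t x : (s <= t)%N -> survival t x <= survival s x.
Proof.
elim: t => [|t IHt]; first by rewrite leqn0 => /eqP ->.
rewrite leq_eqVlt => /predU1P[->//|]; rewrite ltnS => /IHt; apply: le_trans.
have /andP[s0 _] := survival_itv t x.
have /andP[_ f1] := survival_factor t (x t).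
by rewrite survivalS ler_piMr.
Qed.

Lemma eq_survival t x y : (forall s, (s < t)%N -> x s = y s) ->
  survival t x = survival t y.
Proof. by move=> xy; apply: eq_bigr => s _; rewrite xy. Qed.

(** Stop as soon as the survival probability, inclusive of the current time,
    falls below the threshold [U]. Survival decreases in time, so stopping after
    [t] means [U <= survival t.+1], an event of conditional probability
    [survival t.+1] given the path. *)
Definition flow_time (w : Omega) : option nat :=
  if pselect (exists t, survival t.+1 (X^~ w) < U w) is left e
  then Some (ex_minn e) else None.

Lemma flow_time_at_least t w :
  at_least flow_time t.+1 w <-> U w <= survival t.+1 (X^~ w).
Proof.
rewrite /at_least /flow_time /=; case: pselect => [e|ne]; last first.
  by split=> // _; rewrite leNgt; apply/negP => lt; apply: ne; exists t.
case: ex_minnP => m Um minm; split=> [/(_ m erefl) tm|Ut _ [<-]].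
  by rewrite leNgt; apply/negP => /minm; rewrite leqNgt tm.
rewrite ltnNge; apply/negP => mt; move: Um.
by rewrite ltNge (le_trans Ut)// survival_le.
Qed.

Lemma history_survival m t f w : (m <= t.+1)%N -> history t w = f ->
  survival m (X^~ w) = survival m (fun s => f (inord s)).
Proof.
move=> mt <-; apply: eq_survival => s sm.
by rewrite ffunE /= inordK// (leq_trans sm).
Qed.

Lemma flow_time_stopping : is_stopping_time U X flow_time.
Proof.
apply/is_stopping_timeP => t; apply/filtrationP => f.
exists [set` `]-oo, survival t.+1 (fun s => f (inord s))]].
  exact: measurable_itv.
by move=> w /history_survival <-//; rewrite flow_time_at_least /= in_itv.
Qed.

(** For [m = 0] the event is the whole space, which is not the event
    [U <= survival 0 = 1]; the two agree only almost surely. *)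
Lemma flow_time_history m t f : (m <= t.+1)%N ->
  P (at_least flow_time m `&` history t @^-1` [set f]) =
  ((survival m (fun s => f (inord s)))%:E * P (history t @^-1` [set f]))%E.
Proof.
case: m => [|m] mt.
  by rewrite at_least0 setTI /survival big_ord0 mul1e.
set c := survival _ _.
rewrite (_ : _ `&` _ = U @^-1` [set` `]-oo, c]] `&` history t @^-1` [set f]).
  rewrite (indep_U_sigma_X hUX (measurable_itv _) (@history_sigma_X t f)).
  by rewrite uniform01_cdf// survival_itv.
apply/seteqP; split=> w [] /=; rewrite in_itv /= => + wf.
  by move=> /flow_time_at_least; rewrite (history_survival mt wf).
by rewrite /c -(history_survival mt wf) => /flow_time_at_least.
Qed.

Lemma flow_time_step t i :
  arriving flow_time t i - stopping flow_time t i =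
  (1 - stop t i / arr t i) * arriving flow_time t i.
Proof.
have onf (A : set Omega) f :
    P (A `&` X t @^-1` [set i] `&` history t @^-1` [set f]) =
    if f ord_max == i then P (A `&` history t @^-1` [set f]) else 0%E.
  have hist_last w : history t w = f -> f ord_max = X t w.
    by move=> <-; rewrite ffunE.
  case: eqP => fi.
    congr (P _); apply/seteqP; split=> [w [[Aw _] wf]//|w [Aw wf]].
    by split=> //; split=> //=; rewrite -(hist_last w).
  rewrite (_ : _ `&` _ = set0) ?measure0//.
  apply/seteqP; split=> // w [[_ wi] /= /hist_last fE].
  by apply: fi; rewrite fE.
apply/EFin_inj; rewrite -(continuingE flow_time_stopping) EFinM.
rewrite -(arrivingE flow_time_stopping).
have mA s : measurable (at_least flow_time s `&` X t @^-1` [set i]).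
  by apply: measurableI => //; exact: measurable_at_least flow_time_stopping _.
rewrite (total_probability (mA t.+1) (@measurable_history t)).
rewrite (total_probability (mA t) (@measurable_history t)).
rewrite ge0_sume_distrr//; apply: eq_bigr => f _.
rewrite !onf; case: eqP => [fi|_]; last by rewrite mule0.
rewrite !flow_time_history// survivalS.
rewrite (_ : inord t = ord_max) ?fi; last by apply/val_inj; rewrite /= inordK.
by rewrite muleA -EFinM [X in X%:E]mulrC.
Qed.

(** Both flows obey the same recursion and stop the same fraction of what
    arrives. *)
Lemma flow_time_arriving t i : arriving flow_time t i = arr t i.
Proof.
have [T0 _ TS] := stopping_flow flow_time_stopping.
case: hflow => arr0 arrP arrS.
elim: t i => [|t IHt] i; first by rewrite T0 arr0.
rewrite TS arrS; apply: eq_bigr => k _.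
rewrite flow_time_step IHt; congr (_ * _).
rewrite mulrBl mul1r.
have [a0|an0] := eqVneq (arr t k) 0; last by rewrite divfK.
have := arrP t k; rewrite a0 mulr0 => /andP[s0 s0'].
by lra.
Qed.

Lemma flow_time_stops t i : stopping flow_time t i = stop t i.
Proof.
have := flow_time_step t i; rewrite flow_time_arriving mulrBl mul1r.
have [a0|an0] := eqVneq (arr t i) 0; last by rewrite divfK// => /addrI/oppr_inj.
have [_ /(_ t i) + _] := stopping_flow flow_time_stopping.
have [_ /(_ t i) + _] := hflow.
rewrite flow_time_arriving a0 => /andP[s0 s0'] /andP[s1 s1'] _.
by apply/eqP; rewrite eq_le !(le_trans _ s0, le_trans _ s1).
Qed.

End Realization.

(** * Bounds on the mean time *)

(** Optional stopping for the supermartingale [h (X_t) - t], in the limit of the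
    bounded times T /\ m; the part of the mass still in motion at [m] is dropped
    as [h] is nonnegative. *)
Lemma mean_time_lower_bound (nu h : 'I_n -> R) T :
  (forall i, 0 <= h i) -> (forall i, \sum_j p i j * h j - h i <= 1) ->
  transports_to U X nu T ->
  ((\sum_i nu i * h i - \sum_i mu i * h i)%:E <= mean_time P T)%E.
Proof.
move=> h0 drift [hT _ law].
have flow := stopping_flow hT.
have alive_ge0 t : 0 <= \sum_i (arriving T t i - stopping T t i).
  by apply: sumr_ge0 => i _; rewrite subr_ge0; case: flow => _ /(_ t i) /andP[].
have partial_le m :
    ((\sum_(t < m) \sum_i (arriving T t i - stopping T t i))%:E
     <= mean_time P T)%E.
  pose u t := (\sum_i (arriving T t i - stopping T t i))%:E.
  have := @nneseries_lim_ge R u xpredT 0 m (fun t _ _ => alive_ge0 t).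
  by rewrite mean_timeE// big_mkord sumEFin.
have stop_cvg i : \sum_(0 <= t < m) stopping T t i @[m --> \oo] --> nu i.
  have := stopped_law_cvg hT (i := i); rewrite law.
  by move/fine_cvg.
have := partial_le 0%N; rewrite big_ord0.
case E : (mean_time P T) => [M| |] // _; last by rewrite leey.
rewrite lee_fin lerBlDr.
have := @cvg_weighted_sum _ _ _ _ h stop_cvg.
move/cvgr_to_le; apply; apply: nearW => m.
have -> : \sum_i (\sum_(0 <= t < m) stopping T t i) * h i =
    \sum_(t < m) \sum_i stopping T t i * h i.
  rewrite exchange_big /=; apply: eq_bigr => i _.
  by rewrite big_mkord mulr_suml.
have [_ stop_le _] := flow.
have := flow_balance h m flow.
have : 0 <= \sum_i arriving T m i * h i.
  apply: sumr_ge0 => i _; rewrite mulr_ge0//.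
  by case/andP: (stop_le m i) => s0; exact: le_trans.
have := partial_le m; rewrite E lee_fin.
have : \sum_(t < m) \sum_i (arriving T t i - stopping T t i) *
      (\sum_j p i j * h j - h i) <=
    \sum_(t < m) \sum_i (arriving T t i - stopping T t i).
  apply: ler_sum => t _; apply: ler_sum => i _; rewrite ler_piMr//.
  by rewrite subr_ge0; case/andP: (stop_le t i).
lra.
Qed.

Section FillingTime.
Hypothesis hU : is_uniform01 U.
Hypothesis p_ge0 : forall i j, 0 <= p i j.
Hypothesis p_sum1 : forall i, \sum_j p i j = 1.
Variables (nu h : 'I_n -> R) (j : 'I_n).
Hypothesis mu_dist : is_distribution mu.
Hypothesis nu_dist : is_distribution nu.
Hypothesis h_ge0 : forall i, 0 <= h i.
Hypothesis drift1 : forall i, i != j -> \sum_k p i k * h k - h i = 1.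
Hypothesis halt : forall t, fill_stop p mu nu t j = fill_arr p mu nu t j.

Let T := flow_time (fill_arr p mu nu) (fill_stop p mu nu).
Let hflow := filling_is_flow p_ge0 mu_dist nu_dist.
Let hT : is_stopping_time U X T := flow_time_stopping hflow.

Lemma filling_mean_time :
  mean_time P T = (\sum_i nu i * h i - \sum_i mu i * h i)%:E.
Proof.
rewrite mean_timeE//; apply/cvg_lim => //.
rewrite (_ : (fun m => _) = EFin \o (fun m =>
    \sum_(t < m) \sum_i (fill_arr p mu nu t i - fill_stop p mu nu t i))).
  by apply: cvg_EFin; [exact: nearW | exact: filling_work_cvg drift1 halt].
apply/funext => m /=; rewrite sumEFin big_mkord; congr _%:E.
apply: eq_bigr => t _; apply: eq_bigr => i _.
by rewrite flow_time_arriving// flow_time_stops.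
Qed.

(** The time is finite almost surely because never stopping is at most as likely
    as surviving [t] steps, for every [t]. *)
Lemma filling_transports : transports_to U X nu T.
Proof.
have law i : P [set w | exists2 k, T w = Some k & X k w = i] = (nu i)%:E.
  apply: (cvg_unique _ (stopped_law_cvg hT (i := i))) => //=.
  apply: cvg_EFin; first exact: nearW.
  rewrite (_ : _ \o _ = fun m => \sum_(t < m) fill_stop p mu nu t i).
    exact: filling_stop_cvg drift1 halt i.
  apply/funext => m /=; rewrite big_mkord; apply: eq_bigr => t _.
  by rewrite flow_time_stops.
split=> //.
pose never := [set w | T w = None].
have mS t : measurable (stops_at T t) by exact: measurable_stops_at.
have neverE : never = ~` \bigcup_t stops_at T t.
  apply/seteqP; split=> w; rewrite /never /stops_at /=.
    by move=> Tw [t _ /=]; rewrite Tw.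
  by case Tw: (T w) => [k|] // nk; case: nk; exists k.
have mnever : measurable never.
  by rewrite neverE; apply: measurableC; exact: bigcup_measurable.
exists never; split=> //; last by move=> w /negP; rewrite negbK => /eqP.
have c_le t : fine (P never) <= \sum_i fill_arr p mu nu t.+1 i.
  rewrite -lee_fin fineK ?fin_num_measure// fill_arrS_mass//.
  apply: (le_trans (y := P (at_least T t.+1))).
    apply: le_measure; rewrite ?inE//; first exact: measurable_at_least.
    by move=> w Tw k; rewrite Tw.
  rewrite tail_probability// lee_fin; apply: ler_sum => i _.
  by rewrite flow_time_arriving// flow_time_stops.
have c0 : fine (P never) <= 0.
  have := filling_mass_cvg0 p_ge0 p_sum1 mu_dist nu_dist h_ge0 drift1 halt.
  rewrite -cvg_shiftS => /cvgr_to_ge; apply; exact: nearW.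
apply/eqP; rewrite eq_le measure_ge0 andbT -[leLHS]fineK ?lee_fin//.
exact: fin_num_measure.
Qed.

End FillingTime.

End History.

(** * The transport time of the winning streak chain *)

Theorem theorem2p3 (R : realType) (d : measure_display)
  (Omega : measurableType d) (P : probability Omega R)
  (n : nat) (hn : (2 <= n)%N)
  (mu nu : 'I_n -> R) (hmu : is_distribution mu) (hnu : is_distribution nu)
  (U : {RV P >-> R}) (X : nat -> Omega -> 'I_n)
  (hX : is_markov_chain P X mu (@winning_streak R n))
  (hU : is_uniform01 U) (hUX : indep_UX U X) :
  transport_time U X nu =
    (\big[maxe/-oo]_(j < n)
       (mean nu (fun z => 2 ^+ z * (z <= label j)%N%:R)
        - mean mu (fun z => 2 ^+ z * (z <= label j)%N%:R))%:E)%E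
  /\ ((Num.max (mean nu (fun z => 2 ^+ z) - mean mu (fun z => 2 ^+ z)) 0)%:E
        <= transport_time U X nu)%E
  /\ (transport_time U X nu <= (2 ^+ n)%:E)%E.
Proof.
pose gap (j : 'I_n) :=
  mean nu (truncated_pow2 R j) - mean mu (truncated_pow2 R j).
rewrite (_ : (\big[maxe/-oo]_(j < n) _)%E =
  (\big[maxe/-oo]_(j < n) (gap j)%:E)%E)//.
have h_ge0 (j i : 'I_n) : 0 <= truncated_pow2 R j (label i).
  by rewrite mulr_ge0.
have drift_le (j i : 'I_n) :
    \sum_k winning_streak R i k * truncated_pow2 R j (label k)
    - truncated_pow2 R j (label i) <= 1.
  by rewrite truncated_pow2_drift// gerBl mulr_ge0.
have lower j : ((gap j)%:E <= transport_time U X nu)%E.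
  apply/ereal_infP => _ [T hT <-].
  exact: (mean_time_lower_bound hX hUX (h_ge0 j) (drift_le j) hT).
have p_ge0 := @winning_streak_ge0 R n.
have p_sum1 := @winning_streak_sum1 R n hn.
(* The halting state of the filling rule is where the maximum is attained. *)
have [j halt] := fill_halting_state p_ge0 p_sum1 hmu hnu.
have drift1 i : i != j ->
    \sum_k winning_streak R i k * truncated_pow2 R j (label k)
    - truncated_pow2 R j (label i) = 1.
  by move=> /negbTE ij; rewrite truncated_pow2_drift// ij mul0r subr0.
have upper : (transport_time U X nu <= (gap j)%:E)%E.
  have transp := filling_transports hX hUX hU p_ge0 p_sum1 hmu hnu (h_ge0 j)
    drift1 halt.
  have timeE := filling_mean_time hX hUX hU p_ge0 p_sum1 hmu hnu (h_ge0 j)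
    drift1 halt.
  apply: ge_ereal_inf; rewrite -timeE; eexists; last exact: lexx.
  by eexists; first exact: transp.
split; last split.
- apply/eqP; rewrite eq_le; apply/andP; split.
    by apply: (le_trans upper); exact: (le_bigmax _ (fun j => (gap j)%:E)).
  by apply: bigmax_le => [|i _]; [exact: leNye | exact: lower].
- rewrite EFin_max ge_max; apply/andP; split.
    have n1 : (n.-1 < n)%N by rewrite (ltn_predK hn).
    (* For j = n nothing is truncated. *)
    have fullE (m : 'I_n -> R) : mean m (fun z => 2 ^+ z) =
        mean m (truncated_pow2 R (Ordinal n1)).
      apply: eq_bigr => i _; rewrite /truncated_pow2 /label /= (ltn_predK hn).
      by rewrite ltn_ord mulr1.
    by rewrite !fullE; exact: lower.
  apply/ereal_infP => _ [T hT <-]; apply: integral_ge0 => w _.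
  by case: (T w) => [k|] //=; rewrite lee_fin.
- apply: (le_trans upper); rewrite lee_fin lerBlDr -[leLHS]addr0 lerD//.
    have [nu0 nu1] := hnu.
    apply: (le_trans (y := \sum_i nu i * 2 ^+ n)); last first.
      by rewrite -mulr_suml nu1 mul1r.
    apply: ler_sum => i _; rewrite ler_wpM2l// /truncated_pow2.
    apply: (le_trans (y := 2 ^+ label i)).
      by rewrite ler_piMr ?exprn_ge0// lern1 leq_b1.
    by rewrite ler_eXn2l ?ltr1n//; exact: ltn_ord.
  by apply: sumr_ge0 => i _; rewrite mulr_ge0//; case: hmu.
Qed.
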